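(* Let $\beta\in \mathrm{Sym}_n(\mathbb Q)$ be positive semi-definite of rank $n-1$ and let $\ell\subset V$ be a rational isotropic line. Then there is a finite number of rational $n$-dimensional subspaces $U_1,\dots,U_a$ of $\ell^\perp$ such that $$\{U_1,\dots,U_a\}=\{\mathrm{span}(X):X\in\Omega_{\beta,\ell}\cap(L^n+h)\}.$$
   Context: $V$ is a $\mathbb Q$-vector space of dimension $p+1$ with a non-degenerate symmetric bilinear form $(\,,)$ of signature $(p,1)$, having nonzero rational isotropic vectors; $L\subset V$ is a $\mathbb Z$-lattice of full rank with $L\subset L^{\#}$ (dual lattice); $1\le n\le p$ and $h\in(L^{\#})^n$. For $X=(x_1,\dots,x_n)\in V^n$, $(X,X)$ is the matrix $((x_i,x_j))$ and $R(X)$ is the radical of the subspace $\mathrm{span}(X)$, i.e. $\{u\in\mathrm{span}(X):(u,\mathrm{span}(X))=0\}$. Put $\Omega_{\beta,\ell}=\{X\in V^n:\frac12(X,X)=\beta,\ R(X)=\ell\}$; its elements have entries in $\ell^\perp$. *)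

(* Defs.v *)
From HB Require Import structures.
From mathcomp Require Import all_boot all_order all_algebra.

Set Implicit Arguments.
Unset Strict Implicit.
Unset Printing Implicit Defensive.

Import Order.TTheory GRing.Theory Num.Theory.
Local Open Scope ring_scope.

Section QuadraticSpace.
Variables (V : vectType rat) (f : {symmetric V}).

(* Read off a rational orthogonal basis; by Sylvester's law of inertia the
   counts do not depend on the basis and agree with those over the reals. *)
Definition has_signature (r s : nat) : Prop :=
  exists e : seq V,
    [/\ basis_of fullv e, pairwise_orthogonal f e,
        count (fun v => 0 < f v v) e = r & count (fun v => f v v < 0) e = s].

Definition is_lattice (L : V -> Prop) : Prop :=
  exists e : (\dim {:V}).-tuple V,
    basis_of fullv e /\ forall x, L x <-> inIntSpan e x.

Definition dual_lattice (L : V -> Prop) (x : V) : Prop :=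
  forall y, L y -> f x y \is a Num.int.

Definition isotropic_line (l : {vspace V}) : Prop :=
  \dim l = 1%N /\ {in l, forall u, f u u = 0}.

Definition radical (U : {vspace V}) : {vspace V} := (U :&: orthov f U)%VS.

Variable n : nat.
Implicit Types X h : n.-tuple V.

Definition gram X : 'M[rat]_n := \matrix_(i, j) f (tnth X i) (tnth X j).

Definition Omega (beta : 'M[rat]_n) (l : {vspace V}) X : Prop :=
  2^-1 *: gram X = beta /\ radical <<X>>%VS = l.

Definition lattice_coset (L : V -> Prop) h X : Prop :=
  forall i, L (tnth X i - tnth h i).

End QuadraticSpace.

Definition pos_semidef (n : nat) (beta : 'M[rat]_n) : Prop :=
  forall v : 'rV[rat]_n, 0 <= (v *m beta *m v^T) 0 0.

(* Main.v *)
Require Import Defs.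
From HB Require Import structures.
From mathcomp Require Import all_boot all_order all_algebra.
From mathcomp Require Import ring lra.
From Stdlib Require Import Classical.

Set Implicit Arguments.
Unset Strict Implicit.
Unset Printing Implicit Defensive.

Import Order.TTheory GRing.Theory Num.Theory.
Local Open Scope ring_scope.

(** The form is positive semi-definite on [l^⊥] with radical [l].  Fix a basis
    [w] of [l^⊥].  For [X] in [Omega] meeting the coset, the numbers
    [f (X i) (w k)] have bounded denominators, as [X i] lies in the dual
    lattice, and they are bounded because [2 |f x w| <= f x x + f w w] on
    [l^⊥], where [f (X i) (X i)] is prescribed by [beta].  Hence they take
    finitely many values.  They determine each [X i] modulo [l^⊥⊥ = l], and
    [l] is contained in [<<X>>], so they determine [<<X>>]. *)

(** * Finiteness and common denominators *)

(** Used with [C] the finite type of codes and [P c t] saying that some admissible tuple with code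
    [c] spans [t]. Whether a code is realised need not be decidable, so excluded middle selects an
    optional value for each [c]. *)
Lemma finite_image_rel (C : finType) (T : eqType) (P : C -> T -> Prop) :
  (forall c t t', P c t -> P c t' -> t = t') ->
  exists s : seq T, forall t, t \in s <-> exists c, P c t.
Proof.
move=> Pfun.
have /fin_all_exists[g gP] : forall c, exists o : option T,
    forall t, o = Some t <-> P c t.
  move=> c; have [[t Pct]|nP] := classic (exists t, P c t).
    exists (Some t) => t'; split=> [[<-] //|Pct'].
    by rewrite (Pfun _ _ _ Pct Pct').
  by exists None => t; split=> // Pct; case: nP; exists t.
exists (pmap g (enum C)) => t; rewrite mem_pmap; split=> [/mapP[c _ e]|[c Pct]].
  by exists c; apply/gP.
by apply/mapP; exists c; rewrite ?mem_enum //; apply/esym/gP.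
Qed.

Lemma common_denominator (I : finType) (a : I -> rat) :
  exists2 d : int, d != 0 & forall i, a i * d%:~R \is a Num.int.
Proof.
exists (\prod_i denq (a i)); first by apply/prodf_neq0 => i _; exact: denq_neq0.
move=> i; rewrite (bigD1 i) //= intrM mulrA -numqE -intrM.
exact: intr_int.
Qed.

Lemma finite_bounded_denominator (d : int) (r : rat) : d != 0 ->
  exists s : seq rat,
    forall y : rat, y * d%:~R \is a Num.int -> `|y| <= r -> y \in s.
Proof.
(* If [y = m / d] with [m] an integer, the bound on [y] gives [|m| <= r * |d| < N], so [y] is one of
   the fractions [± i / d] with [i < N]. *)
move=> d0; pose N := Num.bound (r * `|d%:~R|).
pose q (i : nat) : rat := i%:R / d%:~R.
have dR0 : d%:~R != 0 :> rat by rewrite intr_eq0.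
exists (map q (iota 0 N) ++ map (fun i => - q i) (iota 0 N)) => y.
move=> /intrP[m ydm] yr; have yE : y = m%:~R / d%:~R by rewrite -ydm mulfK.
have mN : (`|m| < N)%N.
  rewrite -(ltr_nat rat); apply: le_lt_trans (archi_boundP _); last first.
    by rewrite mulr_ge0 // (le_trans _ yr).
  rewrite -[X in X <= _]/((`|m|%N : int)%:~R) abszE intr_norm -ydm normrM.
  by rewrite ler_wpM2r.
rewrite mem_cat; have [m0|m0] := lerP 0 m; apply/orP; [left|right];
  apply/mapP; exists `|m|%N; rewrite ?mem_iota //= yE /q
  -[X in X / _]/((`|m|%N : int)%:~R).
  by rewrite gez0_abs.
by rewrite ltz0_abs // mulrNz mulNr opprK.
Qed.

(** * Spans modulo a subspace, and the double orthogonal of a line *)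

Lemma span_le_mod (F : fieldType) (V : vectType F) (n : nat)
  (X Y : n.-tuple V) (l : {vspace V}) : (l <= <<Y>>)%VS ->
  (forall i, tnth X i - tnth Y i \in l) -> (<<X>> <= <<Y>>)%VS.
Proof.
move=> lY XY; apply/span_subvP => _ /tnthP[i ->].
rewrite -[tnth X i](subrK (tnth Y i)) memvD //.
  exact: (subvP lY).
by rewrite memv_span ?mem_tnth.
Qed.

Lemma symmetricC (R : nzRingType) (V : lmodType R) (f : {symmetric V}) x y :
  f x y = f y x.
Proof. by rewrite hermC expr0 mul1r. Qed.

(** For [u != 0] pick [v] with [f u v != 0]. Every [t] is a multiple of [v] plus a vector of [u^⊥],
    on which [z] vanishes. So [z] pairs with [t] exactly as a fixed multiple of [u] does, and
    nondegeneracy identifies the two. *)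
Lemma orthov_orthov_line (F : fieldType) (V : vectType F) (f : {symmetric V})
  (u z : V) : nondegenerate f ->
  z \in orthov f (orthov f <[u]>) -> z \in <[u]>%VS.
Proof.
move=> /eqP nd /mem_orthovP zP.
have [u0|u0] := eqVneq u 0.
  have: z \in orthov f fullv.
    by apply/mem_orthovP => v _; apply: zP; rewrite mem_orthov1 u0 linear0r.
  by rewrite nd memv0 => /eqP->; rewrite mem0v.
have /mem_orthovPn[v _ uv] : u \notin orthov f fullv by rewrite nd memv0.
suff: z - (f z v / f u v) *: u \in orthov f fullv.
  by rewrite nd memv0 subr_eq0 => /eqP->; rewrite memvZ ?memv_line.
apply/mem_orthovP => t _.
have /zP : t - (f t u / f u v) *: v \in orthov f <[u]>.
  by rewrite mem_orthov1 linearBl linearZl /= (symmetricC f v) mulfVK ?subrr.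
rewrite linearBr linearZr /= => /eqP; rewrite subr_eq0 => /eqP zt.
rewrite linearBl linearZl /= zt (symmetricC f u t); field.
by rewrite uv.
Qed.

(** * Signature, dual lattices and Gram matrices *)

Section SymmetricForm.
Variables (V : vectType rat) (f : {symmetric V}).

(** By induction on [e]: a positive head [v] is orthogonal to the span of the positive vectors after
    it, so [a *: v + y] has norm [a ^+ 2 * f v v + f y y], a sum of two nonnegative terms. *)
Lemma posdef_span_pos (e : seq V) : pairwise_orthogonal f e ->
  forall x, x \in <<[seq v <- e | (0 < f v v)%R]>>%VS ->
  0 <= f x x ?= iff (x == 0).
Proof.
case/andP=> _; elim: e => [|v e IH] /= => [_ x|].
  by rewrite span_nil memv0 => /eqP->; rewrite linear0r eqxx; apply: leifP.
case/andP=> /andP[/allP ve _] /IH{}IH; case: ifP => // v0 x.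
rewrite span_cons => /memv_addP[_ /vlineP[a ->] [y ye ->]].
have vy : f v y = 0.
  rewrite symmetricC; apply/eqP; rewrite -mem_orthov1; move: y ye.
  apply/subvP/span_subvP => t; rewrite mem_filter => /andP[_ /ve /eqP tv].
  by rewrite mem_orthov1 symmetricC tv.
have fE : f (a *: v + y) (a *: v + y) = a ^+ 2 * f v v + f y y.
  rewrite hnormDd; last by rewrite linearZl /= vy mulr0.
  by rewrite linearZl linearZr /= mulrA.
have := IH y ye => -[y0 yE].
have av0 : 0 <= a ^+ 2 * f v v by rewrite mulr_ge0 ?sqr_ge0 // ltW.
rewrite fE; split; first by rewrite addr_ge0.
apply/eqP/eqP => [/esym/eqP|xy0].
  rewrite paddr_eq0 // mulf_eq0 (gt_eqF v0) orbF expf_eq0 /= eq_sym.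
  by rewrite (eq_sym (f y y)) yE => /andP[/eqP<- /eqP->]; rewrite scale0r addr0.
by rewrite -fE xy0 linear0r.
Qed.

(* One non-positive direction [e0] is available: if [x ⊥ u] and [u] is
   isotropic, a combination [b x - a u] with [b != 0] has no [e0]-component, and
   its norm is [b^2 f x x]. *)
Lemma isotropic_orthov_psd (p : nat) (u : V) :
  \dim {:V} = p.+1 -> has_signature f p 1 -> u != 0 -> f u u = 0 ->
  forall x, x \in orthov f <[u]> -> 0 <= f x x.
Proof.
move=> dimV [e [be oe pe _]] u0 uu x; rewrite mem_orthov1 => /eqP xu.
have posP := posdef_span_pos oe; set P := [seq v <- e | _] in posP.
(* The basis has [p + 1] vectors, [p] of them positive, so exactly one is left. *)
have [e0 NE] : exists e0, [seq v <- e | ~~ (0 < f v v)] = [:: e0].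
  set N := filter _ _.
  have : size N = 1%N.
    have := count_predC (fun v => 0 < f v v) e.
    rewrite pe -(eqP (basis_free be)) (span_basis be) dimV size_filter -addn1.
    by move/addnI.
  by case: N => [|e0 []] // _; exists e0.
have split_e z : exists a, z - a *: e0 \in <<P>>%VS.
  have : z \in <<e>>%VS by rewrite (span_basis be) memvf.
  have /perm_mem/eq_span <- := permEl (perm_filterC (fun v => 0 < f v v) e).
  rewrite span_cat NE span_seq1 => /memv_addP[y yP [_ /vlineP[a ->] ->]].
  by exists a; rewrite addrK.
have [[a xP] [b uP]] := (split_e x, split_e u).
(* Otherwise [u] would be a nonzero isotropic vector in the positive definite span of [P]. *)
have b0 : b != 0.
  apply: contraNneq u0 => b0; move: uP; rewrite b0 scale0r subr0 => /posP.
  by case=> _; rewrite uu eqxx => <-.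
have : b *: x - a *: u \in <<P>>%VS.
  have -> : b *: x - a *: u = b *: (x - a *: e0) - a *: (u - b *: e0).
    by rewrite !scalerBr !scalerA (mulrC b) opprB addrA subrK.
  by rewrite memvB ?memvZ.
case/posP=> + _; rewrite hnormBd; last first.
  by rewrite linearZl linearZr /= xu !mulr0.
rewrite !linearZl !linearZr /= uu !mulr0 addr0 mulrA -expr2.
by rewrite pmulr_rge0 // exprn_even_gt0.
Qed.

Lemma psd_norm_le (U : {vspace V}) : {in U, forall x, 0 <= f x x} ->
  {in U &, forall x y, `|f x y| <= f x x + f y y}.
Proof.
move=> psd x y xU yU.
(* The norms of [x + y] and [x - y] bound [2 * |f x y|]; those of [x] and [y] allow the factor 2 to
   be dropped. *)
have := psd _ (memvD xU yU); have := psd _ (memvB xU yU).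
have := psd _ xU; have := psd _ yU.
rewrite hnormB hnormD expr0 mul1r /= => *; rewrite ler_norml; apply/andP.
by split; lra.
Qed.

(** Clearing the coordinates of [w] in a basis of [L] gives a [d] that serves all dual vectors [x]
    at once, since these pair integrally with the basis. *)
Lemma dual_lattice_denominator (L : V -> Prop) (w : V) : is_lattice L ->
  exists2 d : int, d != 0 &
    forall x, dual_lattice f L x -> f x w * d%:~R \is a Num.int.
Proof.
case=> e [be LE].
have [d d0 dP] := common_denominator (fun j => coord e j w).
exists d => // x xL; rewrite (coord_basis be (memvf w)) linear_sumr mulr_suml.
apply: rpred_sum => j _; rewrite linearZr /= mulrAC rpredM //.
apply/xL/LE; exists [ffun i => (i == j)%:R].
rewrite (bigD1 j) //= ffunE eqxx big1 ?addr0 // => i /negbTE ij.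
by rewrite ffunE ij.
Qed.

Lemma coset_dual_lattice (L : V -> Prop) (n : nat) (h X : n.-tuple V) :
  (forall x, L x -> dual_lattice f L x) ->
  (forall i, dual_lattice f L (tnth h i)) ->
  lattice_coset L h X -> forall i, dual_lattice f L (tnth X i).
Proof.
move=> LL hL XL i y Ly; rewrite -[tnth X i](subrK (tnth h i)) linearDl /=.
by apply: rpredD; [apply: (LL _ (XL i)) | apply: hL].
Qed.

Lemma gram_comb (n : nat) (X : n.-tuple V) (v : 'rV[rat]_n) j :
  (v *m gram f X) 0 j = f (\sum_i v 0 i *: tnth X i) (tnth X j).
Proof.
by rewrite mxE linear_sumlz; apply: eq_bigr => i _; rewrite mxE linearZl.
Qed.

(* The relations among the entries of [X] and the coordinates of a generator
   of the radical both lie in the kernel of the Gram matrix, which is a line. *)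
Lemma dim_span_gram (n : nat) (X : n.-tuple V) :
  (0 < n)%N -> \rank (gram f X) = n.-1 -> \dim (radical f <<X>>%VS) = 1%N ->
  \dim <<X>>%VS = n.
Proof.
move=> n0 rk dim1; suff: free X by move/eqP; rewrite size_tuple.
apply/freeP => k k0; pose v := \row_i k i.
suff v0 : v = 0 by move=> i; have /rowP/(_ i) := v0; rewrite !mxE.
apply: contra_eq dim1 => v0.
have combE (r : 'rV_n) : \sum_i r 0 i *: X`_i = \sum_i r 0 i *: tnth X i.
  by apply: eq_bigr => i _; rewrite (tnth_nth 0).
have vX : \sum_i v 0 i *: tnth X i = 0.
  by rewrite -combE -[RHS]k0; apply: eq_bigr => i _; rewrite mxE.
have vker : (v <= kermx (gram f X))%MS.
  apply/sub_kermxP/rowP => j.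
  by rewrite gram_comb vX linear0l mxE.
(* The kernel has rank [n - n.-1], which is 1 because [n] is positive; the nonzero [v] therefore
   spans it. *)
have kerv : (kermx (gram f X) <= v)%MS.
  rewrite -(geq_leqif (mxrank_leqif_sup vker)) mxrank_ker rk rank_rV v0.
  by case: n n0 {X k k0 v v0 combE vX vker rk} => // n _; rewrite subSnn.
(* A radical vector has coordinates in the kernel, hence proportional to the relation [v], so it
   vanishes; this contradicts [dim1]. *)
suff -> : radical f <<X>>%VS = 0%VS by rewrite dimv0.
apply/eqP; rewrite -subv0; apply/subvP => u /memv_capP[uX /mem_orthovP uO].
pose r := \row_i coord X i u.
have uE : u = \sum_i r 0 i *: tnth X i.
  by rewrite -combE [LHS](coord_span uX); apply: eq_bigr => i _; rewrite mxE.
have : (r <= v)%MS.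
  apply: submx_trans kerv; apply/sub_kermxP/rowP => j.
  by rewrite gram_comb -uE uO ?mxE // memv_span ?mem_tnth.
case/sub_rVP => a rE; rewrite memv0 uE rE.
under eq_bigr do rewrite mxE -scalerA.
by rewrite -scaler_sumr vX scaler0.
Qed.

End SymmetricForm.

(** * Coding tuples by their pairings with a basis of [l^⊥] *)

Theorem lemma3p2
  (p n : nat) (V : vectType rat) (f : {symmetric V})
  (dimV : \dim {:V} = p.+1)
  (f_nondeg : nondegenerate f)
  (f_sig : has_signature f p 1)
  (f_isotropic : exists v : V, v != 0 /\ f v v = 0)
  (L : V -> Prop) (L_lattice : is_lattice L)
  (L_integral : forall x, L x -> dual_lattice f L x)
  (n_ge1 : (1 <= n)%N) (n_le_p : (n <= p)%N)
  (h : n.-tuple V) (h_dual : forall i, dual_lattice f L (tnth h i))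
  (beta : 'M[rat]_n) (beta_sym : beta^T = beta)
  (beta_psd : pos_semidef beta) (beta_rank : \rank beta = n.-1)
  (l : {vspace V}) (l_isotropic : isotropic_line f l) :
  exists Us : seq {vspace V},
    (forall U, U \in Us -> \dim U = n /\ (U <= orthov f l)%VS) /\
    (forall U, U \in Us <->
       exists X : n.-tuple V,
         [/\ Omega f beta l X, lattice_coset L h X & <<X>>%VS = U]).
Proof.
case: l_isotropic => diml l0.
have [u u0 lE] : exists2 u, u != 0 & l = <[u]>%VS.
  have lN0 : vpick l != 0 by rewrite vpick0 -dimv_eq0 diml.
  exists (vpick l) => //; apply/esym/eqP.
  by rewrite eqEdim -memvE memv_pick dim_vline lN0 diml.
have psd : {in orthov f l, forall x, 0 <= f x x}.
  move=> x; rewrite lE; apply: isotropic_orthov_psd dimV f_sig u0 _ x.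
  by apply: l0; rewrite lE memv_line.
have lX X : Omega f beta l X -> (l <= <<X>>)%VS.
  by case=> _ <-; apply: capvSl.
have Xl X : Omega f beta l X -> (<<X>> <= orthov f l)%VS.
  by case=> _ <-; rewrite orthov_sym capvSr.
have Xmem X i : Omega f beta l X -> tnth X i \in orthov f l.
  by move/Xl/subvP; apply; rewrite memv_span ?mem_tnth.
have gramE X : Omega f beta l X -> gram f X = 2 *: beta.
  by case=> <- _; rewrite scalerA divff ?scale1r.
pose m := \dim (orthov f l); pose w := vbasis (orthov f l).
have wl (k : 'I_m) : tnth w k \in orthov f l by rewrite vbasis_mem ?mem_tnth.
pose coded X (c : 'I_n * 'I_m -> rat) :=
  forall i k, f (tnth X i) (tnth w k) = c (i, k).
have /fin_all_exists[s sP] : forall ik : 'I_n * 'I_m, exists s : seq rat,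
    forall X, Omega f beta l X -> lattice_coset L h X ->
    f (tnth X ik.1) (tnth w ik.2) \in s.
  case=> i k /=.
  have [d d0 dP] := dual_lattice_denominator f (tnth w k) L_lattice.
  have [s sP] := finite_bounded_denominator
    (2 * beta i i + f (tnth w k) (tnth w k)) d0.
  exists s => X XO XL; apply: sP.
    by apply/dP/(coset_dual_lattice L_integral h_dual).
  have -> : 2 * beta i i = f (tnth X i) (tnth X i).
    by have /matrixP/(_ i i) := gramE X XO; rewrite !mxE => ->.
  by apply: psd_norm_le psd _ _ _ _; [apply: Xmem | apply: wl].
(* Pooling the finite value lists into one [S] makes the codes a finite function type. *)
pose S := flatten [seq s ik | ik <- enum {: 'I_n * 'I_m}].
pose P (c : {ffun 'I_n * 'I_m -> seq_sub S}) U :=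
  exists X : n.-tuple V, [/\ Omega f beta l X, lattice_coset L h X,
    <<X>>%VS = U & coded X (fun ik => ssval (c ik))].
have coded_le X Y c : Omega f beta l X -> Omega f beta l Y ->
    coded X c -> coded Y c -> (<<X>> <= <<Y>>)%VS.
  move=> XO YO Xc Yc; apply: (span_le_mod (lX Y YO)) => i.
  (* Equal codes make the difference of the two entries orthogonal to the basis [w], hence to all of
     [l^⊥]. *)
  rewrite lE; apply: (orthov_orthov_line f_nondeg) => //; rewrite -lE.
  rewrite mem_orthov_sym -(span_basis (vbasisP (orthov f l))).
  apply/span_subvP => _ /tnthP[k ->].
  by rewrite mem_orthov1 symmetricC linearBl /= Xc Yc subrr.
have [] := @finite_image_rel _ _ P.
  move=> c U U' [X [XO _ <- Xc]] [Y [YO _ <- Yc]].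
  by apply: subv_anti; rewrite !(coded_le _ _ (fun ik => ssval (c ik))).
move=> Us UsP.
have UsE U : U \in Us <-> exists X : n.-tuple V,
    [/\ Omega f beta l X, lattice_coset L h X & <<X>>%VS = U].
  apply: iff_trans (UsP U) _.
  split=> [[c [X [XO XL XU _]]]|[X [XO XL XU]]]; first by exists X.
  have inS ik : f (tnth X ik.1) (tnth w ik.2) \in S.
    by apply/flatten_mapP; exists ik; rewrite ?mem_enum ?sP.
  exists [ffun ik => SeqSub (inS ik)]; exists X; split=> // i k.
  by rewrite ffunE.
exists Us; split=> // U /UsE[X [XO _ <-]]; split; last exact: Xl.
apply: (@dim_span_gram _ f _ _ n_ge1); last by case: XO => _ ->.
by rewrite gramE // mxrank_scale_nz.
Qed.
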